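(* Consider a candidate $g_\eta$ of the form $g_\eta(\theta)=\exp(-D_A(\theta\|\eta))$, let $s\in\{+1,-1\}$, and let $$H_s(\eta)=s\big(\nabla^2\hat\ell(\eta)-\nabla^2A(\eta)\big).$$ Assume $H_s(\eta)\succ0$, so that the local quadratic approximation (around $\eta$) of the inner problem $\operatorname{ext}_{\theta\in\Theta}\{-\hat\ell(\theta)-\log g_\eta(\theta)\}$ is concave for $s=+1$ and convex for $s=-1$. Danskin's theorem then gives $$\nabla\mathrm{CBO}_s(\eta)=\nabla^2A(\eta)\,(\eta-\theta_s),\qquad \theta_s=\operatorname*{argext}_{\theta\in\Theta}\{-\hat\ell(\theta)-\log g_\eta(\theta)\}.$$ Replacing the inner objective $\theta\mapsto-\hat\ell(\theta)-\log g_\eta(\theta)$ by its second-order Taylor expansion around $\eta$ and minimizing the resulting surrogate via natural gradient descent yields the Newton-like update $$\eta_{t+1}=\eta_t-\rho_t\,H_s(\eta_t)^{-1}\,\nabla\hat\ell(\eta_t),$$ with step size $\rho_t>0$.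
   Context: $\Theta\subseteq\mathbb{R}^d$ is the parameter set, and $A$ is the log-partition function on $\Theta$ of a regular and minimal exponential family. $D_A(\theta\|\eta)=A(\theta)-A(\eta)-\nabla A(\eta)^{\intercal}(\theta-\eta)$ is the Bregman divergence of $A$. A possibility function on $\Theta$ is a function $\Theta\to[0,1]$ with supremum $1$; $g_\eta$ is a possibility function parameterized by its mode $\eta\in\Theta$. $\hat\ell(\theta)=\ell(\theta)-\log\pi(\theta)$ is the regularized loss, for a loss function $\ell$ and a prior possibility function $\pi$. The consistency bounds are $$\mathrm{CBO}_s(\eta)=\operatorname*{ext}_{\theta\in\Theta}\Big\{-\ell(\theta)-\log\frac{g_\eta(\theta)}{\pi(\theta)}\Big\}=\operatorname*{ext}_{\theta\in\Theta}\{-\hat\ell(\theta)-\log g_\eta(\theta)\},$$ where $\operatorname{ext}=\sup$ and $\operatorname{argext}=\operatorname{argsup}$ if $s=+1$ (upper consistency bound), and $\operatorname{ext}=\inf$ and $\operatorname{argext}=\operatorname{arginf}$ if $s=-1$ (lower consistency bound). The associated objective is to minimize $s\,\mathrm{CBO}_s$ over $\eta$. Natural gradient descent here means gradient descent on the objective $s\,\mathrm{CBO}_s$ preconditioned by $(\nabla^2A(\eta))^{-1}$, i.e. $\eta_{t+1}=\eta_t-\rho_t(\nabla^2A(\eta_t))^{-1}s\,\nabla\mathrm{CBO}_s(\eta_t)$; the surrogate amounts to using in the gradient formula, in place of $\theta_s$, the extremizer of the second-order Taylor expansion of the inner objective. $M\succ0$ means that $M$ is positive definite.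
   Formalization: The gradient formula is proved for a unique θ_s, assuming either that near η the extremum is attained in a fixed compact subset of Θ (Danskin's compactness condition) or that H_s≻0 on all of Θ; with H_s≻0 only at η the formula can fail. *)

(* Defs.v *)
(* A point of R^d is a row vector 'rV[R]_d, so a
   matrix-vector product M v with M a d x d matrix is written v *m M^T, that is
   v *m M for the symmetric matrices (Hessians and their inverses) used here. *)
From HB Require Import structures.
From mathcomp Require Import all_boot all_order all_algebra.
From mathcomp Require Import all_classical all_reals all_analysis.

Set Implicit Arguments.
Unset Strict Implicit.
Unset Printing Implicit Defensive.
Import Order.TTheory GRing.Theory Num.Theory.
Import numFieldNormedType.Exports.

Local Open Scope classical_set_scope.
Local Open Scope ring_scope.

Section Calculus.
Context {R : realType} {d : nat}.
Implicit Types (f : 'rV[R]_d -> R) (u v a x : 'rV[R]_d) (M : 'M[R]_d).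

Definition dotv u v : R := (u *m v^T) 0 0.

Definition posdef M : Prop :=
  M^T = M /\ forall v, v != 0 -> 0 < dotv (v *m M) v.

Definition grad f x : 'rV[R]_d := \row_(i < d) 'D_(delta_mx 0 i) f x.

Definition hess f x : 'M[R]_d := 'J (grad f) x.

(* The derivatives are Frechet derivatives; neither grad f nor hess f is
   required to be continuous on D beyond what this entails. *)
Definition twice_differentiable_on (D : set 'rV[R]_d) f : Prop :=
  forall x, D x -> differentiable f x /\ differentiable (grad f) x.

Definition taylor2 f a x : R :=
  f a + dotv (grad f a) (x - a) + 2^-1 * dotv ((x - a) *m hess f a) (x - a).

Definition bregman (A : 'rV[R]_d -> R) (theta eta : 'rV[R]_d) : R :=
  A theta - A eta - dotv (grad A eta) (theta - eta).

End Calculus.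

Section ExponentialFamily.
Context {R : realType} {d : nat} {disp : measure_display}
        {X : measurableType disp}.
Variables (mu : {measure set X -> \bar R}) (T : X -> 'rV[R]_d).

(* The density of the family with respect to the base measure mu is
   exp (<theta, T x> - A theta). *)
Definition natural_space : set 'rV[R]_d :=
  [set theta | (\int[mu]_x (expR (dotv theta (T x)))%:E < +oo)%E].

Definition log_partition (theta : 'rV[R]_d) : R :=
  ln (fine (\int[mu]_x (expR (dotv theta (T x)))%:E)%E).

Record regular_minimal_family : Prop := RegularMinimalFamily {
  family_measurable : forall i, measurable_fun setT (fun x => T x 0 i) ;
  family_regular : open natural_space ;
  family_minimal : forall (v : 'rV[R]_d) (c : R), v != 0 ->
    ~ {ae mu, forall x, dotv v (T x) = c} }.

End ExponentialFamily.

(* The sign s: upper is s = +1, lower is s = -1. *)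
Variant side := upper | lower.

Definition sgn (R : realType) (s : side) : R :=
  match s with upper => 1 | lower => -1 end.
Arguments sgn {R} s.

Section ConsistencyBound.
Context {R : realType} {d : nat}.
Variables (s : side) (Theta : set 'rV[R]_d).
Implicit Types (f ell pi : 'rV[R]_d -> R) (g : 'rV[R]_d -> 'rV[R]_d -> R).

Definition ext (S : set (\bar R)) : \bar R :=
  match s with upper => ereal_sup S | lower => ereal_inf S end.

Definition is_ext (D : set 'rV[R]_d) f (t : 'rV[R]_d) : Prop :=
  D t /\ forall x, D x ->
    match s with upper => f x <= f t | lower => f t <= f x end.

(* t is the point argext_D f: an extremizer exists, and it is unique. *)
Definition is_argext (D : set 'rV[R]_d) f (t : 'rV[R]_d) : Prop :=
  is_ext D f t /\ forall x, is_ext D f x -> x = t.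

(* Concave for s = +1, convex for s = -1. *)
Definition side_curved f : Prop :=
  match s with
  | upper => convex_function setT (fun x => - f x)
  | lower => convex_function setT f
  end.

Definition possibility (p : 'rV[R]_d -> R) : Prop :=
  (forall theta, Theta theta -> 0 <= p theta <= 1) /\
  sup [set p theta | theta in Theta] = 1.

Definition reg_loss ell pi (theta : 'rV[R]_d) : R := ell theta - ln (pi theta).

Definition inner_objective ell pi g (eta theta : 'rV[R]_d) : R :=
  - reg_loss ell pi theta - ln (g eta theta).

Definition CBO ell pi g (eta : 'rV[R]_d) : \bar R :=
  ext [set (- ell theta - ln (g eta theta / pi theta))%:E | theta in Theta].

(* The compactness requirement of Danskin's theorem, for the open parameter set
   Theta: for all parameters close to eta the extremum over Theta is reached
   inside one fixed compact subset of Theta. *)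
Definition locally_attained (phi : 'rV[R]_d -> 'rV[R]_d -> R)
    (eta : 'rV[R]_d) : Prop :=
  exists K : set 'rV[R]_d, [/\ compact K, K `<=` Theta &
    \forall eta' \near eta, exists2 theta, K theta & is_ext Theta (phi eta') theta].

Definition candidate (A : 'rV[R]_d -> R) (eta theta : 'rV[R]_d) : R :=
  expR (- bregman A theta eta).

Definition Hs (lhat A : 'rV[R]_d -> R) (eta : 'rV[R]_d) : 'M[R]_d :=
  sgn s *: (hess lhat eta - hess A eta).

(* CBO takes values in \bar R: having gradient v at eta includes being finite
   in a neighbourhood of eta. *)
Definition has_gradient (F : 'rV[R]_d -> \bar R) (eta v : 'rV[R]_d) : Prop :=
  [/\ \forall eta' \near eta, F eta' \is a fin_num,
      differentiable (fine \o F) eta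
    & grad (fine \o F) eta = v].

(* One step of gradient descent, preconditioned by (nabla^2 A)^-1, on an
   objective s F where G stands for the gradient of F at eta. *)
Definition natural_gradient_step (A : 'rV[R]_d -> R) (rho : R)
    (eta G : 'rV[R]_d) : 'rV[R]_d :=
  eta - rho *: ((sgn s *: G) *m invmx (hess A eta)).

End ConsistencyBound.

(* Main.v *)
(** The integrals of f exp <theta, T> against the base measure, for f of
    subexponential growth in T, are Frechet differentiable on the natural
    parameter space, with differential obtained by replacing f with f <h, T>.
    Hence A is twice differentiable there and its Hessian is the covariance of
    T, which minimality makes positive definite.

    Up to a function of theta alone, the inner objective depends on eta through
    - A eta - <grad A eta, theta - eta>. If theta_s and theta' are extremizers
    at eta and eta', comparing the objectives at both points bounds
    |CBO eta' - phi eta' theta_s| by |<grad A eta' - grad A eta, theta' - theta_s>|,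
    which is o(|eta' - eta|) because theta' tends to theta_s. The gradient
    formula follows without differentiating grad A twice. When H_s is positive
    definite throughout, the objective is concave (up to the sign s) along
    segments of the convex set Theta, so being lower than at theta_s on a small
    sphere around it confines the extremizers at nearby eta' to a fixed ball. *)
Require Import Defs.
From HB Require Import structures.
From mathcomp Require Import all_boot all_order all_algebra.
From mathcomp Require Import all_classical all_reals all_analysis.
From mathcomp Require Import measurable_realfun ring lra.
Import Order.TTheory GRing.Theory Num.Theory.
Import numFieldNormedType.Exports.
Local Open Scope classical_set_scope.
Local Open Scope ring_scope.

Set Implicit Arguments.
Unset Strict Implicit.
Unset Printing Implicit Defensive.

(** * Dot products and Frechet derivatives *)

Section Dot.
Context {R : realType} {d : nat}.
Implicit Types (u v w : 'rV[R]_d).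

Lemma dotvE u v : dotv u v = \sum_i u 0 i * v 0 i.
Proof. by rewrite /dotv mxE; apply: eq_bigr => i _; rewrite mxE. Qed.

Lemma dotvC u v : dotv u v = dotv v u.
Proof. by rewrite !dotvE; apply: eq_bigr => i _; rewrite mulrC. Qed.

Lemma dotvDl u v w : dotv (u + v) w = dotv u w + dotv v w.
Proof. by rewrite /dotv mulmxDl mxE. Qed.

Lemma dotvDr u v w : dotv w (u + v) = dotv w u + dotv w v.
Proof. by rewrite !(dotvC w) dotvDl. Qed.

Lemma dotvZl (a : R) u w : dotv (a *: u) w = a * dotv u w.
Proof. by rewrite /dotv -scalemxAl mxE. Qed.

Lemma dotvZr (a : R) u w : dotv w (a *: u) = a * dotv w u.
Proof. by rewrite !(dotvC w) dotvZl. Qed.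

Lemma dotvNl u w : dotv (- u) w = - dotv u w.
Proof. by rewrite -scaleN1r dotvZl mulN1r. Qed.

Lemma dotvNr u w : dotv w (- u) = - dotv w u.
Proof. by rewrite -scaleN1r dotvZr mulN1r. Qed.

Lemma dotvBl u v w : dotv (u - v) w = dotv u w - dotv v w.
Proof. by rewrite dotvDl dotvNl. Qed.

Lemma dotvBr u v w : dotv w (u - v) = dotv w u - dotv w v.
Proof. by rewrite dotvDr dotvNr. Qed.

Lemma dotv0l w : dotv 0 w = 0.
Proof. by rewrite -(scale0r 0) dotvZl mul0r. Qed.

Lemma dotv0r w : dotv w 0 = 0.
Proof. by rewrite dotvC dotv0l. Qed.

Lemma dotv_delta u i : dotv u (delta_mx 0 i) = u 0 i.
Proof.
rewrite dotvE (bigD1 i)//= !mxE !eqxx mulr1 big1 ?addr0// => j ji.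
by rewrite !mxE (negbTE ji) andbF mulr0.
Qed.

Lemma dotv_mulmxl u v (M : 'M[R]_d) : dotv (u *m M) v = dotv u (v *m M^T).
Proof. by rewrite /dotv trmx_mul trmxK mulmxA. Qed.

Lemma ler_coord_norm u i : `|u 0 i| <= `|u|.
Proof.
rewrite [leRHS]/Num.norm/= mx_normrE.
by rewrite (le_trans _ (le_bigmax _ _ (0, i))).
Qed.

Lemma ler_norm_dotv u v : `|dotv u v| <= d%:R * `|u| * `|v|.
Proof.
rewrite dotvE (le_trans (ler_norm_sum _ _ _))//.
rewrite (@le_trans _ _ (\sum_(i < d) `|u| * `|v|))//.
  by apply: ler_sum => i _; rewrite normrM ler_pM// ler_coord_norm.
by rewrite sumr_const card_ord -mulrA mulr_natl.
Qed.

End Dot.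

Section Diff.
Context {R : realType}.

(** The domain is finite-dimensional: expanding along the canonical basis gives a finite sum of
    differentiable coordinate terms. *)
Lemma linear_rV_continuous d (W : normedModType R)
  (f : {linear 'rV[R]_d -> W}) : continuous f.
Proof.
have -> : (f : _ -> _) =
    \sum_(i < d) (fun h : 'rV[R]_d => h 0 i *: f (delta_mx 0 i)).
  apply/funext => h; rewrite fct_sumE [in LHS](row_sum_delta h) linear_sum.
  by apply: eq_bigr => i _; rewrite linearZ.
move=> x; apply: differentiable_continuous; apply: differentiable_sum => i.
exact/differentiableZl/differentiable_coord.
Qed.

(** Turns an explicit remainder estimate into a differential; used for the tilted integrals and for
    the consistency bound. *)
Lemma is_diff_bound (V W : normedModType R) (f : V -> W) (df : {linear V -> W})
    (x : V) : continuous df ->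
  (forall e : R, 0 < e ->
    \forall h \near (0 : V), `|f (h + x) - f x - df h| <= e * `|h|) ->
  is_diff x f df.
Proof.
move=> cdf H.
have E : f \o shift x = cst (f x) + df +o_ (0 : V) id.
  apply/eqaddoP => e e0; near=> h.
  rewrite /= !fctE opprD addrA; near: h; exact: H.
have dE := diff_unique cdf E.
by apply: DiffDef => //; apply/diff_locallyP; rewrite dE.
Unshelve. all: by end_near. Qed.

(** Differentials are local. This matters because the gradient formulas below hold only on the open
    parameter set. *)
Lemma is_diff_near (V W : normedModType R) (f g df : V -> W) (x : V) :
  {near x, f =1 g} -> is_diff x f df -> is_diff x g df.
Proof.
move=> fg [dfx <-]; apply: is_diff_bound; first exact: diff_continuous.
move=> e e0; have := diff_locally dfx => /eqaddoP/(_ e e0) H.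
have fg0 := nbhs_singleton fg.
have fgn : \forall h \near (0 : V), f (h + x) = g (h + x).
  by move: fg; rewrite (near_shift 0 x)/= subr0; apply: filterS => h /=; rewrite ?subr0.
near=> h; rewrite -fg0 -(near fgn h)//.
have : `|(f \o shift x - (cst (f x) + 'd f x)) h| <= e * `|h|.
  by near: h; exact: H.
by rewrite /= !fctE opprD addrA.
Unshelve. all: by end_near. Qed.

Lemma is_diff_littleo (V W : normedModType R) (f df : V -> W) (x : V) :
  is_diff x f df -> forall e : R, 0 < e ->
    \forall y \near x, `|f y - f x - df (y - x)| <= e * `|y - x|.
Proof.
move=> [dfx <-] e e0; have := diff_locally dfx => /eqaddoP/(_ e e0) H.
rewrite (near_shift 0 x)/=; apply: filterS H => h.
by rewrite /= !fctE opprD addrA /= subr0 addrK.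
Qed.

Lemma is_diff_differentiable (V W : normedModType R) (f df : V -> W) (x : V) :
  is_diff x f df -> differentiable f x.
Proof. by case. Qed.

Lemma is_diff_uniq (V W : normedModType R) (f df dg : V -> W) (x : V) :
  is_diff x f df -> is_diff x f dg -> df = dg.
Proof. by case=> _ <- [_ <-]. Qed.

Context {d : nat}.
Implicit Types (f : 'rV[R]_d -> R) (x p : 'rV[R]_d).

Lemma diff_grad f x : differentiable f x -> is_diff x f (dotv (grad f x)).
Proof.
move=> df; apply: DiffDef => //; apply/funext => h.
rewrite [in LHS](row_sum_delta h) linear_sum dotvE.
by apply: eq_bigr => i _; rewrite linearZ/= mxE deriveE// mulrC.
Qed.

Lemma grad_diff f x p : is_diff x f (dotv p) -> grad f x = p.
Proof.
move=> [df dfE]; apply/rowP => i.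
by rewrite mxE deriveE// dfE dotv_delta.
Qed.

Lemma diff_hess f x : differentiable (grad f) x ->
  is_diff x (grad f) (fun h => h *m hess f x).
Proof.
move=> df; apply: DiffDef => //; apply/funext => h.
by rewrite /hess /jacobian mul_rV_lin1.
Qed.

Lemma hess_diff f x (M : 'M[R]_d) :
  is_diff x (grad f) (fun h => h *m M) -> hess f x = M.
Proof.
move=> [df dfE]; apply/row_matrixP => i.
by rewrite !rowE /hess /jacobian mul_rV_lin1/= dfE.
Qed.

Lemma differentiable_row m (F : 'rV[R]_d -> 'rV[R]_m) x :
  (forall j, differentiable (fun y => F y 0 j) x) -> differentiable F x.
Proof.
move=> dF.
have -> : F = \sum_(j < m) (fun y => F y 0 j *: delta_mx 0 j).
  by apply/funext => y; rewrite fct_sumE -row_sum_delta.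
by apply: differentiable_sum => j; exact: differentiableZl.
Qed.

Lemma is_diff_dotvl (v x : 'rV[R]_d) : is_diff x (dotv^~ v) (dotv^~ v).
Proof.
have Llin : linear (dotv^~ v : 'rV[R]_d -> R).
  by move=> a u w; rewrite dotvDl dotvZl.
pose L : {linear 'rV[R]_d -> R} :=
  HB.pack (dotv^~ v : 'rV[R]_d -> R) (GRing.isLinear.Build _ _ _ _ _ Llin).
have cL : continuous L by exact: linear_rV_continuous.
have dL : is_diff x L L.
  by apply: DiffDef; [exact: linear_differentiable|exact: diff_lin].
exact: dL.
Qed.

Lemma is_diff_dotv (F dF : 'rV[R]_d -> 'rV[R]_d) x v :
  is_diff x F dF -> is_diff x (fun y => dotv (F y) v) (fun h => dotv (dF h) v).
Proof. by move=> dFx; exact: (is_diff_comp dFx (is_diff_dotvl v (F x))). Qed.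

End Diff.

(** * Exponential families *)

(** Multiplying [1 - y <= expR (- y)] by [expR y] gives [expR y - 1 <= y * expR y], so the remainder
    lies between 0 and [y * (expR y - 1)]; the sign of [y] then decides the final bound. *)
Lemma expR_taylor1 (R : realType) (y : R) :
  `|expR y - 1 - y| <= `|y| ^+ 2 * expR `|y|.
Proof.
have h1 := expR_ge1Dx y; have h2 := expR_ge1Dx (- y).
have e0 := expR_gt0 y; have eN : expR y * expR (- y) = 1 by rewrite -expRD subrr expR0.
rewrite ger0_norm; last by rewrite -addrA -opprD subr_ge0.
have hu : expR y - 1 <= y * expR y by nra.
have [y0|y0] := leP 0 y.
  rewrite (ger0_norm y0); nra.
rewrite (ltr0_norm y0).
nra.
Qed.

(** * Differentiation under the integral sign on the natural parameter space *)

Section TiltedIntegral.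
Context {R : realType} {d : nat} {disp : measure_display}
        {X : measurableType disp}.
Variables (mu : {measure set X -> \bar R}) (T : X -> 'rV[R]_d).
Hypothesis d0 : (0 < d)%N.
Hypothesis mT : forall i, measurable_fun setT (fun x => T x 0 i).
Hypothesis openT : open (natural_space mu T).

Local Notation Theta := (natural_space mu T).

Lemma measurable_dotv v : measurable_fun setT (fun x => dotv v (T x)).
Proof.
under eq_fun do rewrite dotvE.
apply: measurable_sum => i; exact: measurable_funM.
Qed.

Lemma measurable_expR_dotv v : measurable_fun setT (fun x => expR (dotv v (T x))).
Proof. exact: measurableT_comp (measurable_dotv v). Qed.

Lemma natural_spaceP theta : Theta theta <->
  mu.-integrable setT (EFin \o (fun x => expR (dotv theta (T x)))).
Proof.
split => [h|/integrableP[_]].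
  apply/integrableP; split; first exact/measurable_EFinP/measurable_expR_dotv.
  by under eq_integral do rewrite /= ger0_norm ?expR_ge0//.
by under eq_integral do rewrite /= ger0_norm ?expR_ge0//.
Qed.

(** By openness, [theta] shifted by [a] or [- a] along any axis stays in [Theta]. The norm of [T x]
    is the absolute value of one coordinate, so one of these shifted exponentials equals the left
    side, and [B] is the sum of all of them. *)
Lemma natural_space_dominated theta : Theta theta -> exists2 a, 0 < a &
  exists2 B : X -> R, mu.-integrable setT (EFin \o B) &
    forall x, expR (a * `|T x|) * expR (dotv theta (T x)) <= B x.
Proof.
move=> Tt; have /nbhs_ballP[r /= r0 rT] := open_nbhs_nbhs (conj openT Tt).
pose a := r / 2; have a0 : 0 < a by rewrite divr_gt0.
have inT i (s : bool) : Theta (theta + ((-1) ^+ s * a) *: delta_mx 0 i).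
  apply: rT; rewrite -ball_normE /= opprD addrA subrr sub0r normrN normrZ.
  rewrite normrM normrX normrN1 expr1n mul1r (gtr0_norm a0).
  have : `|delta_mx 0 i : 'rV[R]_d| <= 1.
    rewrite [leLHS]/Num.norm/= mx_normrE; apply/bigmax_leP; split => // j _.
    by rewrite mxE; case: (_ && _); rewrite ?normr1 ?normr0.
  by rewrite /a; nra.
exists a => //.
exists (fun x => \sum_(i < d)
  (expR (dotv (theta + ((-1) ^+ false * a) *: delta_mx 0 i) (T x)) +
    expR (dotv (theta + ((-1) ^+ true * a) *: delta_mx 0 i) (T x)))).
  rewrite [X in integrable _ _ X](_ : _ = fun x => (\sum_(i < d)
    ((expR (dotv (theta + ((-1) ^+ false * a) *: delta_mx 0 i) (T x)))%:E
   + (expR (dotv (theta + ((-1) ^+ true * a) *: delta_mx 0 i) (T x)))%:E))%E).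
    apply: integrable_sum => // i _; apply: integrableD => //;
      by apply/natural_spaceP; exact: inT.
  by apply/funext => x /=; rewrite -sumEFin; apply: eq_bigr.
move=> x.
(* The sup norm is attained at some coordinate; when [T x = 0], any index will do, and [d0] provides
   one. *)
have [i Hi] : exists i, `|T x| = `|T x 0 i|.
  have [T0|T0] := eqVneq (T x) 0.
    by exists (Ordinal d0); rewrite T0 mxE !normr0.
  have [[k i]] : exists k, `|T x| = `|T x k.1 k.2|.
    by apply: mx_norm_neq0; move: T0; rewrite -normr_eq0.
  rewrite (ord1 k) /= => E.
  by exists i.
rewrite (bigD1 i)//= Hi -expRD.
apply: ler_wpDr.
  by apply: sumr_ge0 => j _; rewrite addr_ge0// expR_ge0.
rewrite !dotvDl !dotvZl !(dotvC (delta_mx _ _)) !dotv_delta expr0 expr1 mul1r.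
rewrite mulN1r addrC.
have [t0|t0] := leP 0 (T x 0 i).
  by rewrite ger0_norm// lerDl expR_ge0.
by rewrite ltr0_norm// mulrN -mulNr lerDr expR_ge0.
Qed.

(** Requiring the bound for every rate [e] makes the class closed under products, by splitting [e]
    in two, while keeping [f] times the density dominated near each point of [Theta]. *)
Definition subexponential (f : X -> R) :=
  measurable_fun setT f /\ forall e : R, 0 < e ->
    exists2 C : R, 0 <= C & forall x, `|f x| <= C * expR (e * `|T x|).

Lemma subexponential_cst c : subexponential (cst c).
Proof.
split=> // e e0; exists `|c| => // x.
rewrite /cst ler_peMr// -expR0 ler_expR; exact: mulr_ge0 (ltW e0) _.
Qed.

Lemma subexponential_dotv v : subexponential (fun x => dotv v (T x)).
Proof.
split=> [|e e0]; first exact: measurable_dotv.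
(* Comes from [e * t <= expR (e * t)] with [t] the norm of [T x]. *)
exists (d%:R * `|v| / e) => [|x]; first by rewrite divr_ge0 ?mulr_ge0// ltW.
rewrite (le_trans (ler_norm_dotv _ _))//.
have dv : 0 <= d%:R * `|v| by rewrite mulr_ge0.
rewrite -[leRHS]mulrA ler_wpM2l// [leRHS]mulrC ler_pdivlMr//.
by have := expR_ge1Dx (e * `|T x|); rewrite mulrC; lra.
Qed.

Lemma subexponentialD f g : subexponential f -> subexponential g ->
  subexponential (f \+ g).
Proof.
move=> [mf fe] [mg ge]; split=> [|e e0]; first exact: measurable_funD.
have [C C0 fC] := fe _ e0; have [D D0 gD] := ge _ e0.
exists (C + D) => [|x]; first exact: addr_ge0.
by rewrite (le_trans (ler_normD _ _))// mulrDl lerD.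
Qed.

Lemma subexponentialM f g : subexponential f -> subexponential g ->
  subexponential (f \* g).
Proof.
move=> [mf fe] [mg ge]; split=> [|e e0]; first exact: measurable_funM.
have e20 : 0 < e / 2 by rewrite divr_gt0.
have [C C0 fC] := fe _ e20; have [D D0 gD] := ge _ e20.
exists (C * D) => [|x]; first exact: mulr_ge0.
rewrite normrM (le_trans (ler_pM _ _ (fC x) (gD x)))// mulrACA -expRD.
by rewrite -mulrDl -splitr.
Qed.

(** The unnormalized expectation of [f] at parameter [theta]; for [f = cst 1] it is the partition
    function. *)
Definition tilted (f : X -> R) (theta : 'rV[R]_d) : R :=
  \int[mu]_x (f x * expR (dotv theta (T x))).

Lemma integrable_tilted f theta : subexponential f -> Theta theta ->
  mu.-integrable setT (EFin \o (fun x => f x * expR (dotv theta (T x)))).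
Proof.
move=> [mf fe] /natural_space_dominated[a a0 [B iB leB]].
have [C C0 fC] := fe _ a0.
have : mu.-integrable setT (fun x => C%:E * (EFin \o B) x)%E by exact: integrableZl.
apply: le_integrable => //.
  by apply/measurable_EFinP/measurable_funM => //; exact: measurable_expR_dotv.
move=> x _ /=; rewrite lee_fin normrM (@ger0_norm _ (expR _)) ?expR_ge0//.
rewrite (le_trans (ler_wpM2r (expR_ge0 _) (fC x)))//.
rewrite (le_trans _ (ler_norm _))//.
by rewrite -mulrA ler_wpM2l.
Qed.

(** On a segment the exponent lies between its endpoint values, so the exponential is at most the
    sum of the two endpoint exponentials. *)
Lemma natural_space_convex a b t : Theta a -> Theta b -> 0 <= t <= 1 ->
  Theta (a + t *: (b - a)).
Proof.
move=> /natural_spaceP ia /natural_spaceP ib /andP[t0 t1].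
apply/natural_spaceP; have := integrableD measurableT ia ib.
apply: le_integrable => //; first exact/measurable_EFinP/measurable_expR_dotv.
move=> x _ /=; rewrite lee_fin !ger0_norm ?addr_ge0 ?expR_ge0//.
rewrite dotvDl dotvZl dotvBl; set u := dotv a _; set v := dotv b _.
have [uv|/ltW uv] := leP u v.
  rewrite (@le_trans _ _ (expR v)) ?lerDr ?expR_ge0// ler_expR; nra.
rewrite (@le_trans _ _ (expR u)) ?lerDl ?expR_ge0// ler_expR; nra.
Qed.

(** With [y = dotv h (T x)], the remainder has integrand [f x * expR (dotv theta (T x)) * (expR y -
    1 - y)], which is dominated by the squared norm of [h] times a fixed integrable function. *)
Lemma is_diff_tilted f theta : subexponential f -> Theta theta ->
  is_diff theta (tilted f)
    (fun h => tilted (f \* (fun x => dotv h (T x))) theta).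
Proof.
move=> fs Tt; pose L h := tilted (f \* (fun x => dotv h (T x))) theta.
have iL h : mu.-integrable setT
    (EFin \o (fun x => (f \* (fun x => dotv h (T x))) x * expR (dotv theta (T x)))).
  apply: integrable_tilted => //; apply: subexponentialM => //.
  exact: subexponential_dotv.
have Llin : linear L.
  move=> c u v; rewrite /L /tilted /GRing.scale/= -RintegralZl//; last exact: iL.
  rewrite -RintegralD//; last exact: iL.
    apply: eq_Rintegral => x _ /=; rewrite dotvDl dotvZl; ring.
  exact: (integrableZl measurableT c (iL u)).
pose L' : {linear 'rV[R]_d -> R} := HB.pack L (GRing.isLinear.Build _ _ _ _ _ Llin).
have cL : continuous L' by exact: linear_rV_continuous.
suff : is_diff theta (tilted f) L' by [].
apply: is_diff_bound => // e e0.
have [a a0 [B iB leB]] := natural_space_dominated Tt.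
(* The rate [a] is shared among three factors: the bound on [f], the bound on [y ^+ 2], and the
   exponential in the Taylor remainder. *)
pose b := a / 3; have b0 : 0 < b by rewrite divr_gt0.
have [mf fe] := fs; have [C C0 fC] := fe _ b0.
(* [C] bounds [f]; the square comes from the bound on [dotv] and from
   [t <= 2 / b * expR (b / 2 * t)]. *)
pose K := C * (d%:R * (2 / b)) ^+ 2.
have K0 : 0 <= K by rewrite mulr_ge0// sqr_ge0.
pose M := K * \int[mu]_x B x.
have nT : \forall h \near (0 : 'rV[R]_d), Theta (h + theta).
  have := open_nbhs_nbhs (conj openT Tt); rewrite -[nbhs _ _]/(\near theta, Theta theta).
  by rewrite (near_shift 0)/= subr0; apply.
have nb : \forall h \near (0 : 'rV[R]_d), `|h| < b / d%:R.
  by apply: nbhs0_lt; rewrite divr_gt0// ltr0n.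
have ne : \forall h \near (0 : 'rV[R]_d), `|h| < e / (`|M| + 1).
  by apply: nbhs0_lt; rewrite divr_gt0// ltr_wpDl.
near=> h.
have hT : Theta (h + theta) by near: h.
have hb : d%:R * `|h| <= b.
  by rewrite mulrC -ler_pdivlMr ?ltr0n// ltW//; near: h.
have he : `|h| * (`|M| + 1) <= e.
  by rewrite -ler_pdivlMr ?ltr_wpDl// ltW//; near: h.
have i1 := integrable_tilted fs hT.
have i2 := integrable_tilted fs Tt.
have i12 := integrableB measurableT i1 i2.
have i3 := iL h.
have i123 := integrableB measurableT i12 i3.
rewrite /= /L /tilted -RintegralB// -RintegralB//.
rewrite (le_trans (le_normr_Rintegral _ _))//.
have iKB : mu.-integrable setT (EFin \o (fun x => `|h| ^+ 2 * K * B x)).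
  exact: (integrableZl measurableT (`|h| ^+ 2 * K) iB).
rewrite (@le_trans _ _ (\int[mu]_x (`|h| ^+ 2 * K * B x)))//; last first.
  rewrite RintegralZl// [leLHS](_ : _ = `|h| * M * `|h|); last by rewrite /M; ring.
  rewrite ler_wpM2r//.
  rewrite (le_trans _ he)// ler_wpM2l//.
  by rewrite (le_trans (ler_norm _))// lerDl.
apply: le_Rintegral => //.
  exact: (integrable_norm i123).
move=> x _ /=.
rewrite dotvDl expRD; set y := dotv h (T x); set E := expR (dotv theta (T x)).
rewrite (_ : _ - _ - _ = f x * E * (expR y - 1 - y)); last ring.
have yb : `|y| <= b * `|T x|.
  by rewrite (le_trans (ler_norm_dotv _ _))// ler_wpM2r.
have E0 : 0 < E by exact: expR_gt0.
have y2 : `|y| ^+ 2 <= `|h| ^+ 2 * (d%:R * (2 / b)) ^+ 2 * expR (b * `|T x|).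
  have -> : expR (b * `|T x|) = expR (b / 2 * `|T x|) ^+ 2.
    by rewrite -expRM_natl; congr expR; field.
  rewrite -!exprMn; apply: lerXn2r; rewrite ?nnegrE//.
    by rewrite !mulr_ge0 ?expR_ge0 ?invr_ge0 ?(ltW b0).
  rewrite (le_trans (ler_norm_dotv _ _))//.
  rewrite [leRHS](_ : _ = d%:R * `|h| * (2 / b * expR (b / 2 * `|T x|)));
    last by ring.
  rewrite ler_wpM2l ?mulr_ge0// mulrAC ler_pdivlMr//.
  by have := expR_ge1Dx (b / 2 * `|T x|); lra.
have ey : expR `|y| <= expR (b * `|T x|) by rewrite ler_expR.
rewrite !normrM (gtr0_norm E0).
have t1 := expR_taylor1 y.
set S := `|h| ^+ 2 * (d%:R * (2 / b)) ^+ 2 * expR (b * `|T x|) in y2 *.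
have t2 : `|expR y - 1 - y| <= S * expR (b * `|T x|).
  by rewrite (le_trans t1)// ler_pM ?expR_ge0// sqr_ge0.
rewrite (@le_trans _ _ (C * expR (b * `|T x|) * E * (S * expR (b * `|T x|))))//.
  by rewrite ler_pM// ?mulr_ge0// ?ler_pM2r//; exact: ltW.
rewrite [leLHS](_ : _ = `|h| ^+ 2 * K * (expR (a * `|T x|) * E)).
  by rewrite ler_wpM2l// mulr_ge0// sqr_ge0.
have -> : expR (a * `|T x|) = expR (b * `|T x|) * expR (b * `|T x|) * expR (b * `|T x|).
  by rewrite -!expRD; congr expR; rewrite /b; field.
rewrite /K /S; ring.
Unshelve. all: by end_near. Qed.

End TiltedIntegral.

(** * Derivatives of the log-partition function as moments of the statistic *)

Section LogPartition.
Context {R : realType} {d : nat} {disp : measure_display}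
        {X : measurableType disp}.
Variables (mu : {measure set X -> \bar R}) (T : X -> 'rV[R]_d).
Hypothesis d0 : (0 < d)%N.
Hypothesis hfam : regular_minimal_family mu T.

Local Notation Theta := (natural_space mu T).
Local Notation mT := (family_measurable hfam).
Local Notation openT := (family_regular hfam).
Local Notation A := (log_partition mu T).
Local Notation stat v := (fun x => dotv v (T x)).
Local Notation tilted := (tilted mu T).
Local Notation Z := (tilted (cst 1)).

(** A nonnegative integrand with zero integral vanishes almost everywhere, and the exponential
    factor never vanishes. *)
Lemma tilted_gt0 f theta : subexponential T f -> Theta theta ->
  (forall x, 0 <= f x) -> ~ {ae mu, forall x, f x = 0} -> 0 < tilted f theta.
Proof.
move=> fs Tt f0 fN0; have ifT := integrable_tilted d0 mT openT fs Tt.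
rewrite lt0r andbC; apply/andP; split.
  by apply: Rintegral_ge0 => x _; rewrite mulr_ge0// expR_ge0.
apply/eqP => t0; apply: fN0.
have /(ae_eq_integral_abs mu measurableT)[+ _] := measurable_int _ ifT.
have -> : (\int[mu]_x `|(EFin \o (fun x => f x * expR (dotv theta (T x)))%R) x|)%E = 0%E.
  rewrite -[RHS]/(0%:E) -t0 /tilted /Rintegral fineK; last exact: integrable_fin_num.
  by apply: eq_integral => x _ /=; rewrite ger0_norm// mulr_ge0// expR_ge0.
move=> /(_ erefl); apply: filterS => x /(_ I)/= [/eqP].
by rewrite mulf_eq0 expR_eq0 orbF => /eqP.
Qed.

Lemma is_diff_div (f g df dg : 'rV[R]_d -> R) x :
  is_diff x f df -> is_diff x g dg -> g x != 0 ->
  is_diff x (fun y => f y / g y) (fun h => (df h * g x - f x * dg h) / g x ^+ 2).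
Proof.
move=> fx gx g0.
have gVx : is_diff x (fun y => (g y)^-1) (- g x ^- 2 \*: dg).
  by apply: DiffDef; [exact: differentiableV|rewrite diffV// diff_val].
apply: (is_diff_eq (is_diffM fx gVx)).
apply/funext => h; rewrite !fctE /= /GRing.scale/=.
by field.
Qed.

Lemma is_diff_ln (f df : 'rV[R]_d -> R) x :
  is_diff x f df -> 0 < f x -> is_diff x (fun y => ln (f y)) (fun h => df h / f x).
Proof.
move=> fx f0; have lnx := is_derive1_ln f0.
have dln : differentiable (@ln R) (f x) by apply/derivable1_diffP.
have -> : (fun h => df h / f x) = (fun u => u *: (f x)^-1) \o df by [].
apply: (is_diff_comp fx); apply: DiffDef => //.
by rewrite diff1E// derive1E derive_val.
Qed.

Lemma exists_neq0 : exists v : 'rV[R]_d, v != 0.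
Proof.
exists (delta_mx 0 (Ordinal d0)); apply/eqP => /matrixP/(_ 0 (Ordinal d0)).
by rewrite !mxE !eqxx => /eqP; rewrite oner_eq0.
Qed.

(** Minimality rules out a null base measure, under which every statistic would be almost everywhere
    constant; [d0] supplies a nonzero direction to apply it to. *)
Lemma partition_gt0 theta : Theta theta -> 0 < Z theta.
Proof.
move=> Tt; apply: tilted_gt0 => //; first exact: subexponential_cst.
have [v v0] := exists_neq0; move=> H; apply: (family_minimal hfam (c := 0) v0).
by apply: filterS H => x /eqP; rewrite oner_eq0.
Qed.

Lemma log_partitionE : A = fun theta => ln (Z theta).
Proof.
apply/funext => theta; rewrite /log_partition /tilted /Rintegral.
by congr (ln (fine _)); apply: eq_integral => x _; rewrite mul1r.
Qed.

Lemma near_natural_space theta : Theta theta -> \forall y \near theta, Theta y.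
Proof. by move=> Tt; exact: open_nbhs_nbhs (conj openT Tt). Qed.

Lemma is_diff_log_partition theta : Theta theta ->
  is_diff theta A (fun h => tilted (stat h) theta / Z theta).
Proof.
move=> Tt; rewrite log_partitionE; apply: is_diff_ln; last exact: partition_gt0.
apply: is_diff_eq (is_diff_tilted d0 mT openT (subexponential_cst T 1) Tt) _.
by apply/funext => h; congr tilted; apply/funext => x /=; rewrite mul1r.
Qed.

Lemma dotv_grad_log_partition theta v : Theta theta ->
  dotv (grad A theta) v = tilted (stat v) theta / Z theta.
Proof.
move=> /is_diff_log_partition H; have := diff_grad (is_diff_differentiable H).
by move=> /is_diff_uniq/(_ H)/(congr1 (@^~ v)).
Qed.

(** The gradient is a ratio of tilted integrals on a whole neighbourhood, so the quotient rule
    applies; the result is the covariance of [stat v] and [stat h]. *)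
Lemma is_diff_dotv_grad_log_partition theta v : Theta theta ->
  is_diff theta (fun y => dotv (grad A y) v)
    (fun h => (tilted (stat v \* stat h) theta * Z theta -
               tilted (stat v) theta * tilted (stat h) theta) / Z theta ^+ 2).
Proof.
move=> Tt; apply: is_diff_near.
  apply: filterS (near_natural_space Tt) => y Ty; apply/esym.
  exact: dotv_grad_log_partition.
apply: is_diff_div; last by rewrite gt_eqF// partition_gt0.
  have H := is_diff_tilted d0 mT openT (subexponential_dotv mT v) Tt.
  exact: H.
apply: is_diff_eq (is_diff_tilted d0 mT openT (subexponential_cst T 1) Tt) _.
by apply/funext => h; congr tilted; apply/funext => x /=; rewrite mul1r.
Qed.

Lemma twice_differentiable_log_partition : twice_differentiable_on Theta A.
Proof.
move=> theta Tt; split; first exact: is_diff_differentiable (is_diff_log_partition Tt).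
apply: differentiable_row => j.
have -> : (fun y => grad A y 0 j) = (fun y => dotv (grad A y) (delta_mx 0 j)).
  by apply/funext => y; rewrite dotv_delta.
exact: is_diff_differentiable (is_diff_dotv_grad_log_partition (delta_mx 0 j) Tt).
Qed.

Lemma dotv_hess_log_partition theta u v : Theta theta ->
  dotv (u *m hess A theta) v = (tilted (stat v \* stat u) theta * Z theta -
               tilted (stat v) theta * tilted (stat u) theta) / Z theta ^+ 2.
Proof.
move=> Tt; have [_ dgA] := twice_differentiable_log_partition Tt.
have := is_diff_dotv v (diff_hess dgA).
by move=> /is_diff_uniq/(_ (is_diff_dotv_grad_log_partition v Tt))/(congr1 (@^~ u)).
Qed.

Lemma posdef_hess_log_partition theta : Theta theta -> posdef (hess A theta).
Proof.
move=> Tt; split.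
  apply/matrixP => i j; rewrite mxE.
  have E k l : hess A theta k l = dotv (delta_mx 0 k *m hess A theta) (delta_mx 0 l).
    by rewrite -rowE dotv_delta [RHS]mxE.
  rewrite !E !dotv_hess_log_partition//; congr (_ / _).
  congr (_ * _ - _); last by rewrite mulrC.
  by congr tilted; apply/funext => x /=; rewrite mulrC.
move=> v v0; rewrite dotv_hess_log_partition//.
have Z0 := partition_gt0 Tt; set L := tilted (stat v) theta.
set Q := tilted _ theta; pose c := L / Z theta.
(* Z times the variance of <v, T x> under the density exp (<theta, T x> - A theta) *)
have : 0 < tilted (fun x => (dotv v (T x) - c) ^+ 2) theta.
  apply: tilted_gt0 => //.
  - have -> : (fun x => (dotv v (T x) - c) ^+ 2) =
      (fun x => dotv (v) (T x) - c) \* (fun x => dotv v (T x) - c) by [].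
    have fc : subexponential T (fun x => dotv v (T x) - c).
      exact: subexponentialD (subexponential_dotv mT v) (subexponential_cst T (- c)).
    exact: subexponentialM.
  - by move=> x; exact: sqr_ge0.
  - move=> H; apply: (family_minimal hfam (c := c) v0).
    by apply: filterS H => x /eqP; rewrite sqrf_eq0 subr_eq0 => /eqP.
(* Expand the square and integrate term by term. *)
have -> : tilted (fun x => (dotv v (T x) - c) ^+ 2) theta =
    Q + (- (2 * c)) * L + c ^+ 2 * Z theta.
  have iQ : mu.-integrable setT
      (EFin \o (fun x => (stat v \* stat v) x * expR (dotv theta (T x)))).
    apply: (integrable_tilted d0 mT openT) => //.
    exact/subexponentialM/subexponential_dotv/mT/subexponential_dotv/mT.
  have iL : mu.-integrable setT (EFin \o (fun x => stat v x * expR (dotv theta (T x)))).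
    exact: (integrable_tilted d0 mT openT (subexponential_dotv mT v) Tt).
  have iZ : mu.-integrable setT (EFin \o (fun x => cst 1 x * expR (dotv theta (T x)))).
    exact: (integrable_tilted d0 mT openT (subexponential_cst T 1) Tt).
  have iL2 := integrableZl measurableT (- (2 * c)) iL.
  have iZ2 := integrableZl measurableT (c ^+ 2) iZ.
  rewrite /Q /L /tilted -!RintegralZl// -!RintegralD//.
    by apply: eq_Rintegral => x _ /=; rewrite /cst; ring.
  exact: (integrableD measurableT iQ iL2).
rewrite /c => H; rewrite divr_gt0 ?exprn_gt0//.
have -> : Q * Z theta - L * L =
    Z theta * (Q + - (2 * (L / Z theta)) * L + (L / Z theta) ^+ 2 * Z theta).
  by field; rewrite gt_eqF.
exact: mulr_gt0.
Qed.

End LogPartition.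

(** * Danskin's theorem for the consistency bound *)

Section Objective.
Context {R : realType} {d : nat}.
Implicit Types (A l : 'rV[R]_d -> R) (eta theta : 'rV[R]_d).

Definition objective A l eta theta : R := - l theta + bregman A theta eta.

Lemma inner_objectiveE ell pi A :
  inner_objective ell pi (candidate A) = objective A (reg_loss ell pi).
Proof.
by apply/funext => eta; apply/funext => theta;
   rewrite /inner_objective /candidate expRK opprK.
Qed.

(** The only term coupling [eta] and [theta] is [- dotv (grad A eta) theta], so changing [eta] tilts
    the objective linearly. *)
Lemma objectiveB A l eta eta' theta tau :
  objective A l eta' theta - objective A l eta' tau =
  objective A l eta theta - objective A l eta tau -
  dotv (grad A eta' - grad A eta) (theta - tau).
Proof. by rewrite /objective /bregman dotvBl !dotvBr; ring. Qed.

(** Isolates the first-order remainder of [A], the term producing the derivative in [eta], and a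
    second-order term. *)
Lemma objectiveBl A l eta eta' theta :
  objective A l eta' theta - objective A l eta theta =
  - (A eta' - A eta - dotv (grad A eta) (eta' - eta))
  - dotv (grad A eta' - grad A eta) (theta - eta)
  + dotv (grad A eta' - grad A eta) (eta' - eta).
Proof. by rewrite /objective /bregman !dotvBl !dotvBr; ring. Qed.

Lemma is_diff_objective A l eta theta :
  differentiable A theta -> differentiable l theta ->
  is_diff theta (objective A l eta)
    (dotv (grad A theta - grad l theta - grad A eta)).
Proof.
move=> dA dl; have dA' := diff_grad dA; have dl' := diff_grad dl.
have -> : objective A l eta = (A - l) +
    ((cst (dotv (grad A eta) eta - A eta)) - (dotv^~ (grad A eta))).
  apply/funext => x; rewrite !fctE /objective /bregman dotvBr (dotvC x); ring.
have dp := is_diff_dotvl (grad A eta) theta.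
apply: (is_diff_eq (is_diffD (is_diffB dA' dl') (is_diffB (is_diff_cst _ _) dp))).
by apply/funext => x; rewrite !fctE !dotvBl (dotvC x) add0r.
Qed.

Lemma grad_objective A l eta theta :
  differentiable A theta -> differentiable l theta ->
  grad (objective A l eta) theta = grad A theta - grad l theta - grad A eta.
Proof. by move=> dA dl; exact/grad_diff/is_diff_objective. Qed.

Lemma is_diff_grad_objective (D : set 'rV[R]_d) A l eta theta : open D ->
  twice_differentiable_on D A -> twice_differentiable_on D l -> D theta ->
  is_diff theta (grad (objective A l eta))
    (fun h => h *m (hess A theta - hess l theta)).
Proof.
move=> oD dA dl Dt.
apply: (@is_diff_near _ _ _ ((grad A - grad l) - cst (grad A eta))).
  have : \forall y \near theta, D y := open_nbhs_nbhs (conj oD Dt).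
  apply: filterS => y Dy; rewrite grad_objective//.
    exact: (dA y Dy).1.
  exact: (dl y Dy).1.
have dA' := diff_hess (dA _ Dt).2; have dl' := diff_hess (dl _ Dt).2.
apply: (is_diff_eq (is_diffB (is_diffB dA' dl') (is_diff_cst _ _))).
by apply/funext => h; rewrite !fctE mulmxBr subr0.
Qed.

(** Multiplying by [sgn s] turns both sides into maximization, so the later arguments need no case
    split on [s]. *)
Lemma is_extP s (D : set 'rV[R]_d) f t : is_ext s D f t <->
  D t /\ forall x, D x -> sgn s * f x <= sgn s * f t.
Proof.
case: s => /=; split=> -[Dt H]; split=> // x Dx; move: (H x Dx);
  by rewrite ?mul1r// !mulN1r lerN2.
Qed.

Lemma normr_sgn s : `|sgn s : R| = 1.
Proof. by case: s; rewrite /= ?normrN normr1. Qed.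

Lemma ext_attained s (D : set 'rV[R]_d) (f : 'rV[R]_d -> R) t :
  is_ext s D f t -> ext s [set (f theta)%:E | theta in D] = (f t)%:E.
Proof.
case: s => /= -[Dt H]; apply/eqP; rewrite eq_le; apply/andP; split.
- by apply: ge_ereal_sup => _ [x Dx <-]; rewrite lee_fin; exact: H.
- by apply: ereal_sup_ubound; exists t.
- by apply: ereal_inf_lbound; exists t.
- by apply: le_ereal_inf_tmp => _ [x Dx <-]; rewrite lee_fin; exact: H.
Qed.

End Objective.

Section Danskin.
Context {R : realType} {d : nat}.
Variables (s : side) (Theta : set 'rV[R]_d) (A l : 'rV[R]_d -> R).
Hypothesis dA : twice_differentiable_on Theta A.
Hypothesis dl : twice_differentiable_on Theta l.
Variables (eta ts : 'rV[R]_d).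
Hypothesis Teta : Theta eta.
Hypothesis tsP : is_argext s Theta (objective A l eta) ts.

Local Notation phi := (objective A l).
Local Notation w eta' theta := (sgn s * phi eta' theta).

Lemma continuous_objective (K : set 'rV[R]_d) eta' : K `<=` Theta ->
  {within K, continuous (fun theta => w eta' theta)}.
Proof.
move=> KT; apply: continuous_in_subspaceT => x /set_mem/KT Tx.
apply: (@continuousM _ _ (cst (sgn s))); first exact: cst_continuous.
apply: differentiable_continuous.
exact: is_diff_differentiable (is_diff_objective eta' (dA Tx).1 (dl Tx).1).
Qed.

(** Over the points of [K] far from [ts], the maximum at [eta] is strictly below the value at [ts]
    by uniqueness. By [objectiveB] this gap survives a small change of [grad A], which is continuous
    at [eta]. *)
Lemma extremizer_gap (K : set 'rV[R]_d) (e : R) : compact K -> K `<=` Theta ->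
  0 < e -> \forall eta' \near eta, forall theta, K theta ->
    e <= `|theta - ts| -> w eta' theta < w eta' ts.
Proof.
move=> cK KT e0.
pose K' := K `&` [set theta | e <= `|theta - ts|].
have cK' : compact K'.
  apply: compact_closedI => //.
  have cn : continuous (fun theta : 'rV[R]_d => `|theta - ts|).
    move=> x; apply: continuous_comp; last exact: norm_continuous.
    by apply: continuousB; [exact: cvg_id|exact: cst_continuous].
  exact: (closed_comp _ (@closed_ge R e)).
have [K'0|/set0P K'0] := eqVneq K' set0.
  apply: filterE => eta' theta Kt et.
  by have : K' theta by []; rewrite K'0.
have K'T : K' `<=` Theta by move=> x [/KT].
have [c /set_mem[Kc ec] cmax] :=
  compact_EVT_max K'0 cK' (continuous_objective (eta' := eta) K'T).
have [/is_extP[Tts tsmax] tsuniq] := tsP.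
have gap : 0 < w eta ts - w eta c.
  rewrite subr_gt0 ltNge; apply/negP => H.
  have cts : c = ts.
    apply: tsuniq; apply/is_extP; split; first exact: KT.
    by move=> x Tx; rewrite (le_trans _ H)// tsmax.
  by move: ec; rewrite /= cts subrr normr0 leNgt e0.
have [B [_ KB]] := compact_bounded cK.
(* [M] bounds the distance from [ts] to any point of [K]. *)
pose M := `|B| + 1 + `|ts|.
have M0 : 0 < M by rewrite /M; have := normr_ge0 ts; have := normr_ge0 B; lra.
have KM theta : K theta -> `|theta - ts| <= M.
  move=> Kt; rewrite (le_trans (ler_normB _ _))// /M lerD2r.
  by apply: KB => //; rewrite (le_lt_trans (ler_norm B))// ltrDl.
have cg : {for eta, continuous (grad A)} := differentiable_continuous (dA Teta).2.
have dM0 : 0 < d%:R * M + 1 by rewrite ltr_wpDl// mulr_ge0// ltW.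
near=> eta' => theta Kt et.
have : `|grad A eta - grad A eta'| < (w eta ts - w eta c) / (d%:R * M + 1).
  near: eta'; move/cvgrPdist_lt : cg; apply.
  by rewrite divr_gt0.
rewrite ltr_pdivlMr// => small.
have K't : K' theta by [].
have h1 := cmax _ (mem_set K't).
have h2 := objectiveB A l eta eta' theta ts.
have h3 : `|sgn s * dotv (grad A eta' - grad A eta) (theta - ts)| <=
    `|grad A eta - grad A eta'| * (d%:R * M).
  rewrite normrM normr_sgn mul1r (le_trans (ler_norm_dotv _ _))//.
  rewrite (distrC (grad A eta)) -mulrA mulrCA ler_wpM2l// ler_wpM2l//.
  exact: KM.
have : w eta' theta - w eta' ts = w eta theta - w eta ts -
  sgn s * dotv (grad A eta' - grad A eta) (theta - ts).
  by rewrite -!mulrBr h2.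
have := normr_ge0 (grad A eta - grad A eta').
by move: h1 h3 small; rewrite ler_norml => h1 /andP[h3 _]; nra.
Unshelve. all: by end_near. Qed.


(** Stated for a real function [V] that agrees with the attained values, so that it applies to the
    real part of the extended-real bound. *)
Lemma danskin (V : 'rV[R]_d -> R) : locally_attained s Theta phi eta ->
  (\forall eta' \near eta, forall theta, is_ext s Theta (phi eta') theta ->
     V eta' = phi eta' theta) ->
  is_diff eta V (fun h => dotv (h *m hess A eta) (eta - ts)).
Proof.
move=> [K [cK KT Kext]] VE.
have Llin : linear (fun h => dotv (h *m hess A eta) (eta - ts)).
  by move=> a u v; rewrite mulmxDl -scalemxAl dotvDl dotvZl.
pose L : {linear 'rV[R]_d -> R} := HB.pack
  (fun h => dotv (h *m hess A eta) (eta - ts)) (GRing.isLinear.Build _ _ _ _ _ Llin).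
suff : is_diff eta V L by [].
have cL : continuous L by exact: linear_rV_continuous.
apply: is_diff_bound => // e e0.
have dgA := diff_hess (dA Teta).2; have dA' := diff_grad (dA Teta).1.
have [k k0 Hk] : exists2 k : R, k > 0 & forall h : 'rV[R]_d, `|h *m hess A eta| <= k * `|h|.
  have [_ dE] := dgA.
  have [k k0 H] := linear_lipschitz (diff_continuous (dA Teta).2).
  by exists k => // h; have := H h; rewrite dE.
(* The summands are the coefficients of the four error terms bounded by [q1], [r1], [q2] and
   [q3]. *)
pose D := d%:R * (k + 1) + 1 + d%:R * `|ts - eta| + d%:R * (k + 1).
have D0 : 0 < D.
  have dk : 0 <= d%:R * (k + 1) by rewrite mulr_ge0// addr_ge0// ltW.
  have dt : 0 <= d%:R * `|ts - eta| by rewrite mulr_ge0.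
  by rewrite /D; lra.
(* The bound by 1 serves the Lipschitz estimate [r3]; the bound by [e / D] closes the final
   estimate. *)
pose r := Num.min 1 (e / D).
have r0 : 0 < r by rewrite lt_min ltr01 divr_gt0.
have rD : r * D <= e by rewrite -ler_pdivlMr// ge_min lexx orbT.
rewrite (near_shift eta 0)/=.
have near_eta := extremizer_gap cK KT r0.
have VEeta := nbhs_singleton VE _ tsP.1.
have n1 := is_diff_littleo dA' r0.
have n2 := is_diff_littleo dgA r0.
near=> eta' => /=; rewrite sub0r subrK.
set h := eta' - eta.
have hr : `|h| <= r.
  rewrite distrC; near: eta'.
  have /cvgrPdist_le : (fun y : 'rV[R]_d => y) @ eta --> eta by exact: cvg_id.
  exact.
have r1 : `|A eta' - A eta - dotv (grad A eta) h| <= r * `|h|.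
  by exact: (near n1 eta').
have r2 : `|grad A eta' - grad A eta - h *m hess A eta| <= r * `|h|.
  by exact: (near n2 eta').
have r3 : `|grad A eta' - grad A eta| <= (k + 1) * `|h|.
  have := ler_normD (grad A eta' - grad A eta - h *m hess A eta) (h *m hess A eta).
  rewrite subrK => /le_trans; apply.
  rewrite addrC mulrDl lerD ?Hk// (le_trans r2)// ler_wpM2r//.
  by rewrite ge_min lexx.
have [theta' Kt' ext'] : exists2 theta, K theta & is_ext s Theta (phi eta') theta.
  exact: (near Kext eta').
have -> : V eta' = phi eta' theta' by exact: (near VE eta').
rewrite VEeta.
have /is_extP[Tt' max'] := ext'.
have /is_extP[Tts max] := tsP.1.
have close : `|theta' - ts| <= r.
  rewrite leNgt; apply/negP => /ltW far.
  have : w eta' theta' < w eta' ts.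
    exact: (near near_eta eta').
  by rewrite ltNge max'.
(* Optimality of [theta'] at [eta'] and of [ts] at [eta] gives the two differences opposite signs,
   so the first is controlled by the tilt alone. *)
have q1 : `|phi eta' theta' - phi eta' ts| <= d%:R * ((k + 1) * `|h|) * r.
  have E := objectiveB A l eta eta' theta' ts.
  have g1 : 0 <= sgn s * (phi eta' theta' - phi eta' ts).
    by rewrite mulrBr subr_ge0 max'.
  have g2 : sgn s * (phi eta theta' - phi eta ts) <= 0.
    by rewrite mulrBr subr_le0 max.
  rewrite -[leLHS]mul1r -(normr_sgn s) -normrM (ger0_norm g1) E mulrBr.
  rewrite (@le_trans _ _ `|sgn s * dotv (grad A eta' - grad A eta) (theta' - ts)|)//.
    have := ler_norm (- (sgn s * dotv (grad A eta' - grad A eta) (theta' - ts))).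
    by rewrite normrN; move: g2; lra.
  rewrite normrM normr_sgn mul1r (le_trans (ler_norm_dotv _ _))//.
  by rewrite ler_pM// ?mulr_ge0// ler_wpM2l.
have -> : phi eta' theta' - phi eta ts - dotv (h *m hess A eta) (eta - ts) =
  (phi eta' theta' - phi eta' ts) - (A eta' - A eta - dotv (grad A eta) h)
  - dotv (grad A eta' - grad A eta - h *m hess A eta) (ts - eta)
  + dotv (grad A eta' - grad A eta) h.
  have := objectiveBl A l eta eta' ts; rewrite -/h /= => E.
  rewrite -(opprB ts eta) dotvNr (dotvBl (grad A eta' - grad A eta)).
  by move: E; lra.
have q2 : `|dotv (grad A eta' - grad A eta - h *m hess A eta) (ts - eta)| <=
    d%:R * (r * `|h|) * `|ts - eta|.
  by rewrite (le_trans (ler_norm_dotv _ _))// ler_wpM2r// ler_wpM2l.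
have q3 : `|dotv (grad A eta' - grad A eta) h| <= d%:R * ((k + 1) * `|h|) * r.
  by rewrite (le_trans (ler_norm_dotv _ _))// ler_pM// ?mulr_ge0// ler_wpM2l.
rewrite (le_trans (ler_normD _ _))//.
rewrite (le_trans (lerD (le_trans (ler_normB _ _) (lerD (ler_normB _ _) (lexx _))) (lexx _)))//.
rewrite (le_trans (lerD (lerD (lerD q1 r1) q2) q3))//.
rewrite [leLHS](_ : _ = r * D * `|h|); last by rewrite /D; ring.
by rewrite ler_wpM2r.
Unshelve. all: by end_near. Qed.
End Danskin.

(** * Concavity along segments and attainment under global curvature *)

Section Line.
Context {R : realType}.

Lemma is_derive_line (V W : normedModType R) (f df : V -> W) (x v : V) (t : R) :
  is_diff (x + t *: v) f df ->
  is_derive t 1 (fun t : R => f (x + t *: v)) (df v).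
Proof.
move=> fx.
have lx : is_diff t (cst x + ( *:%R ^~ v : R -> V)) (0 + ( *:%R ^~ v : R -> V)).
  by apply: is_diffD.
have cx : is_diff t (f \o (cst x + ( *:%R ^~ v : R -> V)))
    (df \o (0 + ( *:%R ^~ v : R -> V))).
  exact: is_diff_comp lx fx.
have [dc dE] := cx.
apply: DeriveDef; first exact: (@diff_derivable _ _ _ _ t 1 dc).
by rewrite (deriveE _ dc) dE /= !fctE add0r scale1r.
Qed.

(** If [k t < k 0], the mean value theorem gives a negative slope before [t]; the slopes after [t]
    are no larger, which forces [k 1 < k t]. *)
Lemma above_start (k dk : R -> R) (t : R) : 0 < t < 1 ->
  {in `[0, 1]%R, forall x : R, is_derive x 1 k (dk x)} ->
  {in `[0, 1]%R &, {homo dk : x y / x <= y >-> y <= x}} ->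
  k 0 <= k 1 -> k 0 <= k t.
Proof.
move=> /andP[t0 t1] kd dknincr k01.
have ck (a b : R) : 0 <= a -> b <= 1 -> {within `[a, b], continuous k}.
  move=> a0 b1; apply: derivable_within_continuous => x; rewrite in_itv/= => /andP[ax xb].
  by apply: ex_derive; apply: kd; rewrite in_itv/= (le_trans a0)//= (le_trans xb).
have kd' (a b : R) : 0 <= a -> b <= 1 -> forall x, x \in `]a, b[%R -> is_derive x 1 k (dk x).
  move=> a0 b1 x; rewrite in_itv/= => /andP[/ltW ax /ltW xb].
  by apply: kd; rewrite in_itv/= (le_trans a0)//= (le_trans xb).
have [c1] := MVT t0 (kd' _ _ (lexx _) (ltW t1)) (ck _ _ (lexx _) (ltW t1)).
rewrite in_itv/= => /andP[c10 c1t] E1.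
have [c2] := MVT t1 (kd' _ _ (ltW t0) (lexx _)) (ck _ _ (ltW t0) (lexx _)).
rewrite in_itv/= => /andP[c2t c21] E2.
have : dk c2 <= dk c1.
  by apply: dknincr; rewrite ?in_itv/=; lra.
move=> dk21; rewrite leNgt; apply/negP => kt0.
have dk1 : dk c1 < 0 by rewrite -(pmulr_llt0 _ t0); move: E1; lra.
have : dk c2 * (1 - t) < 0 by rewrite pmulr_llt0 ?subr_gt0// (le_lt_trans dk21).
by move: E2; lra.
Qed.

End Line.

Section GlobalCurvature.
Context {R : realType} {d : nat}.
Variables (s : side) (Theta : set 'rV[R]_d) (A l : 'rV[R]_d -> R).
Hypothesis oTheta : open Theta.
Hypothesis cTheta : forall a b t, Theta a -> Theta b -> 0 <= t <= 1 ->
  Theta (a + t *: (b - a)).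
Hypothesis dA : twice_differentiable_on Theta A.
Hypothesis dl : twice_differentiable_on Theta l.
Hypothesis Hpos : forall theta, Theta theta -> posdef (Hs s l A theta).

Local Notation phi := (objective A l).
Local Notation w eta' theta := (sgn s * phi eta' theta).

(** The Hessian of [phi eta] in [theta] does not depend on [eta]; times [sgn s] it is minus [Hs], so
    the second derivative along the segment is nonpositive. *)
Lemma objective_above_start eta a b t : Theta a -> Theta b -> 0 < t < 1 ->
  w eta a <= w eta b -> w eta a <= w eta (a + t *: (b - a)).
Proof.
move=> Ta Tb t01 ab; set v := b - a.
have Tx x : x \in `[0, 1]%R -> Theta (a + x *: v) by rewrite in_itv/=; exact: cTheta.
pose k x := w eta (a + x *: v).
pose dk x := sgn s * dotv (grad (phi eta) (a + x *: v)) v.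
pose ddk x := sgn s * dotv (v *m (hess A (a + x *: v) - hess l (a + x *: v))) v.
have kd : {in `[0, 1]%R, forall x : R, is_derive x 1 k (dk x)}.
  move=> x /Tx Tax.
  have := is_derive_line (is_diff_objective eta (dA Tax).1 (dl Tax).1).
  rewrite -grad_objective; [|exact: (dA Tax).1|exact: (dl Tax).1].
  by move=> H; exact: (is_deriveZ (sgn s) H).
have dkd : {in `[0, 1]%R, forall x : R, is_derive x 1 dk (ddk x)}.
  move=> x /Tx Tax.
  have := is_derive_line (is_diff_dotv v (is_diff_grad_objective eta oTheta dA dl Tax)).
  by move=> H; exact: (is_deriveZ (sgn s) H).
have ddk0 : {in `[0, 1]%R, forall x : R, ddk x <= 0}.
  move=> x /Tx Tax; rewrite /ddk.
  have [->|v0] := eqVneq v 0; first by rewrite dotv0r mulr0.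
  have [_ /(_ v v0)] := Hpos Tax.
  rewrite /Hs; move: (hess A _) (hess l _) => HA Hl.
  rewrite -scalemxAr dotvZl -(opprB HA) mulmxN dotvNl mulrN.
  by rewrite oppr_gt0 => /ltW.
have k0E : k 0 = w eta a by rewrite /k scale0r addr0.
have k1E : k 1 = w eta b by rewrite /k scale1r addrC subrK.
rewrite -k0E -[w eta (a + _)]/(k t); apply: (above_start t01 kd); last first.
  by rewrite k0E k1E.
(* The increment of [dk] from [x] to [y] is [(y - x)] times a value of [ddk]. *)
move=> x y x01 y01 xy.
have dkd' z : z \in `]x, y[%R -> is_derive z 1 dk (ddk z).
  rewrite in_itv/= => z01; apply: dkd; move: x01 y01 z01; rewrite !in_itv/=; lra.
have [|c] := MVT_segment xy dkd'.
  apply: derivable_within_continuous => z; rewrite in_itv/= => z01.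
  apply: ex_derive; apply: dkd.
  by move: x01 y01 z01; rewrite !in_itv/=; lra.
move=> cxy E.
have c01 : c \in `[0, 1]%R 
  by clear E; move: x01 y01 cxy; rewrite !in_itv/=; lra.
have := ddk0 _ c01.
move: (ddk c) E => D E D0.
by rewrite -subr_le0 E mulr_le0_ge0// subr_ge0.
Qed.

(** [K] is a closed ball around [ts] inside [Theta]. A point outside it with a value at least that
    at [ts] would, by concavity, force such a value on the sphere too, against [extremizer_gap];
    hence a maximizer over [K] is global. *)
Lemma locally_attained_global eta ts : Theta eta ->
  is_argext s Theta (phi eta) ts -> locally_attained s Theta phi eta.
Proof.
move=> Teta tsP; have Tts := tsP.1.1.
have /nbhs_ballP[r /= r0 rT] := open_nbhs_nbhs (conj oTheta Tts).
pose q := r / 2; have q0 : 0 < q by rewrite divr_gt0.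
pose K := [set theta : 'rV[R]_d | `|theta - ts| <= q].
have KT : K `<=` Theta.
  move=> x Kx; apply: rT; rewrite -ball_normE /= distrC (le_lt_trans Kx)//.
  by rewrite /q; lra.
have cK : compact K.
  apply: bounded_closed_compact.
    exists (q + `|ts|); split; first exact: num_real.
    move=> M qM x Kx /=; rewrite (le_trans _ (ltW qM))//.
    by rewrite -[x](subrK ts) (le_trans (ler_normD _ _))// lerD2r.
  have cn : continuous (fun theta : 'rV[R]_d => `|theta - ts|).
    move=> x; apply: continuous_comp; last exact: norm_continuous.
    by apply: continuousB; [exact: cvg_id|exact: cst_continuous].
  exact: (closed_comp _ (@closed_le R q)).
have Kts : K ts by rewrite /K/= subrr normr0 ltW.
exists K; split => //.
have gap := extremizer_gap dA dl Teta tsP cK KT q0.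
near=> eta'.
have [c /set_mem Kc cmax] := compact_EVT_max (ex_intro _ ts Kts) cK
  (continuous_objective (s := s) dA dl (eta' := eta') KT).
exists c => //; apply/is_extP; split; first exact: KT.
move=> x Tx; have [/mem_set/cmax //|qx] := leP `|x - ts| q.
rewrite (le_trans _ (cmax _ (mem_set Kts)))// leNgt; apply/negP => /ltW tsx.
have xts0 : 0 < `|x - ts| by rewrite (lt_trans q0).
(* The parameter at which the segment from [ts] to [x] crosses the sphere. *)
pose t := q / `|x - ts|.
have t01 : 0 < t < 1 by rewrite divr_gt0//= ltr_pdivrMr// mul1r.
have := objective_above_start Tts Tx t01 tsx.
rewrite leNgt => /negP; apply.
have E : `|ts + t *: (x - ts) - ts| = q.
  rewrite addrC addKr normrZ gtr0_norm; last by case/andP: t01.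
  by rewrite /t divfK// gt_eqF.
by apply: (near gap eta') => //; rewrite ?/K/= E.
Unshelve. all: by end_near. Qed.

End GlobalCurvature.

(** * The quadratic surrogate *)

Section Quadratic.
Context {R : realType} {d : nat}.
Implicit Types (H : 'M[R]_d) (u v : 'rV[R]_d).

Lemma posdef_ge0 H v : posdef H -> 0 <= dotv (v *m H) v.
Proof.
move=> [_ Hpos]; have [->|/Hpos/ltW//] := eqVneq v 0.
by rewrite dotv0r.
Qed.

Lemma posdef_unitmx H : posdef H -> H \in unitmx.
Proof.
move=> [_ Hpos]; rewrite -row_free_unit; apply: inj_row_free => v vH0.
by apply/eqP; apply/negPn/negP => /Hpos; rewrite vH0 dotv0l ltxx.
Qed.

Lemma dotv_mulmx_sym H u v : H^T = H -> dotv (u *m H) v = dotv (v *m H) u.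
Proof. by move=> HT; rewrite dotv_mulmxl HT dotvC. Qed.

Lemma sgn_sqr s : sgn s * sgn s = 1 :> R.
Proof. by case: s; rewrite /= ?mulrNN mulr1. Qed.

Lemma taylor2E s f a H x : hess f a = - (sgn s *: H) ->
  taylor2 f a x = f a + dotv (grad f a) (x - a)
    - 2^-1 * (sgn s * dotv ((x - a) *m H) (x - a)).
Proof. by rewrite /taylor2 => ->; rewrite mulmxN dotvNl -scalemxAr dotvZl mulrN. Qed.

(* Complete the square around the stationary point of the quadratic. *)
Lemma taylor2_argext s f a H : posdef H -> hess f a = - (sgn s *: H) ->
  is_argext s setT (taylor2 f a) (a + sgn s *: (grad f a *m invmx H)).
Proof.
move=> Hp fH; have Hu := posdef_unitmx Hp; have [HT Hpos] := Hp.
set v := sgn s *: (grad f a *m invmx H).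
have vH u : dotv (v *m H) u = sgn s * dotv (grad f a) u.
  by rewrite -scalemxAl mulmxKV// dotvZl.
(* The completed square: what is subtracted vanishes only at [a + v], which gives both optimality
   and uniqueness. *)
have E x : sgn s * taylor2 f a x = sgn s * taylor2 f a (a + v)
    - 2^-1 * dotv ((x - (a + v)) *m H) (x - (a + v)).
  have -> : x - (a + v) = (x - a) - v by rewrite opprD addrA.
  rewrite !(taylor2E _ fH) (addrC a v) addrK; move: (x - a) => u.
  rewrite mulmxBl dotvBl !dotvBr (dotv_mulmx_sym u v HT) !vH.
  move: (dotv _ u) (dotv _ v) (dotv _ u) => p q r.
  by clear; case: s => /=; lra.
split.
  apply/is_extP; split=> // x _; rewrite (E x) gerBl mulr_ge0//.
  exact: posdef_ge0.
move=> x /is_extP[_ /(_ (a + v) I)]; rewrite (E x) lerBrDl gerDr.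
have [/eqP|xv] := eqVneq (x - (a + v)) 0; first by rewrite subr_eq0 => /eqP.
by rewrite pmulr_rle0// leNgt Hpos.
Qed.

(** The affine part cancels in the convexity inequality, and the gap is half of [t * (1 - t)] times
    the form [H] at the difference of the endpoints. *)
Lemma taylor2_curved s f a H : posdef H -> hess f a = - (sgn s *: H) ->
  side_curved s (taylor2 f a).
Proof.
move=> Hp fH; have [HT Hpos] := Hp.
suff C : forall (t : R) (x y : 'rV[R]_d), 0 <= t <= 1 ->
    - (sgn s * taylor2 f a (t *: x + (1 - t) *: y)) <=
    t * - (sgn s * taylor2 f a x) + (1 - t) * - (sgn s * taylor2 f a y).
  case: s fH C => /= fH C t x y _ _.
    by have := C t%:num x y; rewrite !mul1r; apply; rewrite ge0 le1.
  by have := C t%:num x y; rewrite !mulN1r !opprK; apply; rewrite ge0 le1.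
move=> t x y /andP[t0 t1].
have za : t *: x + (1 - t) *: y - a = t *: (x - a) + (1 - t) *: (y - a).
  rewrite !scalerBr addrACA -opprD -(scalerDl a t) (addrC t) subrK scale1r.
  by rewrite addrC.
rewrite !(taylor2E _ fH) za; move: (x - a) (y - a) => p q {x y za}.
have := posdef_ge0 (p - q) Hp.
rewrite !mulmxDl mulNmx -!scalemxAl !dotvDl !dotvDr !dotvZl !dotvZr.
rewrite !dotvNl !dotvNr (dotv_mulmx_sym q p HT).
move: (dotv _ p) (dotv _ q) (dotv (p *m H) p) (dotv (p *m H) q) (dotv (q *m H) q).
move=> u v pp pq qq H0.
have {}H0 : 0 <= 2^-1 * (t * (1 - t) * (pp - 2 * pq + qq)).
  rewrite !mulr_ge0 ?subr_ge0//. lra.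
rewrite -subr_ge0; apply: le_trans H0 _; rewrite le_eqVlt; apply/orP; left.
by apply/eqP; case: (s) => /=; field.
Qed.

End Quadratic.

(** * The consistency bound as an attained value, and assembly of the result *)

Section Bound.
Context {R : realType} {d : nat}.
Variables (s : side) (Theta : set 'rV[R]_d) (A ell prior : 'rV[R]_d -> R).
Hypothesis prior_pos : forall theta, Theta theta -> 0 < prior theta.

(** Positivity of the prior on [Theta] lets the logarithm of the quotient split, which identifies
    the two forms of the inner problem. *)
Lemma CBO_attained eta t :
  is_ext s Theta (objective A (reg_loss ell prior) eta) t ->
  CBO s Theta ell prior (candidate A) eta =
  (objective A (reg_loss ell prior) eta t)%:E.
Proof.
move=> tP; rewrite -(ext_attained tP) /CBO; congr (ext s _).
apply: eq_imagel => theta Tt; congr EFin.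
rewrite -inner_objectiveE /inner_objective /reg_loss ln_div ?posrE//; last exact: prior_pos.
  ring.
exact: expR_gt0.
Qed.
End Bound.

Unset Implicit Arguments.

Theorem proposition3 (R : realType) (d : nat) (hd : (0 < d)%N)
    (disp : measure_display) (X : measurableType disp)
    (mu : {measure set X -> \bar R}) (T : X -> 'rV[R]_d)
    (hfam : regular_minimal_family mu T)
    (Theta : set 'rV[R]_d) (hTheta : Theta = natural_space mu T)
    (A : 'rV[R]_d -> R) (hA : A = log_partition mu T)
    (ell prior : 'rV[R]_d -> R)
    (hprior : possibility Theta prior)
    (hprior_pos : forall theta, Theta theta -> 0 < prior theta)
    (lhat : 'rV[R]_d -> R) (hlhat : lhat = reg_loss ell prior)
    (hlhat_diff : twice_differentiable_on Theta lhat)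
    (g : 'rV[R]_d -> 'rV[R]_d -> R) (hg : g = candidate A)
    (s : side)
    (phi : 'rV[R]_d -> 'rV[R]_d -> R)
    (hphi : phi = inner_objective ell prior g) :
  (* the local quadratic approximation is concave (s = +1) or convex (s = -1) *)
  (forall eta, Theta eta -> posdef (Hs s lhat A eta) ->
     side_curved s (taylor2 (phi eta) eta)) /\
  (* gradient of the consistency bound *)
  (forall eta theta_s, Theta eta -> posdef (Hs s lhat A eta) ->
     is_argext s Theta (phi eta) theta_s ->
     locally_attained s Theta phi eta \/
       (forall theta, Theta theta -> posdef (Hs s lhat A theta)) ->
     has_gradient (CBO s Theta ell prior g) eta
       ((eta - theta_s) *m hess A eta)) /\
  (* the update of the surrogate natural gradient descent *)
  (forall (eta : nat -> 'rV[R]_d) (rho : nat -> R) (t : nat),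
     Theta (eta t) -> posdef (Hs s lhat A (eta t)) -> 0 < rho t ->
     exists theta_tilde : 'rV[R]_d,
       is_argext s setT (taylor2 (phi (eta t)) (eta t)) theta_tilde /\
       (eta t.+1 = natural_gradient_step s A (rho t) (eta t)
                     ((eta t - theta_tilde) *m hess A (eta t)) <->
        eta t.+1 = eta t - rho t *:
                     (grad lhat (eta t) *m invmx (Hs s lhat A (eta t))))).
Proof.
have dA : twice_differentiable_on Theta A.
  by rewrite hTheta hA; exact: twice_differentiable_log_partition.
have pA eta : Theta eta -> posdef (hess A eta).
  by rewrite hTheta hA => Te; exact: posdef_hess_log_partition.
have oT : open Theta by rewrite hTheta; exact: family_regular hfam.
have cT a b t : Theta a -> Theta b -> 0 <= t <= 1 -> Theta (a + t *: (b - a)).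
  by rewrite hTheta; apply: natural_space_convex; exact: family_measurable hfam.
have phiE : phi = objective A lhat by rewrite hphi hg hlhat inner_objectiveE.
(* At [theta = eta] the two gradients of [A] cancel. *)
have gphi eta : Theta eta -> grad (phi eta) eta = - grad lhat eta.
  move=> Te; rewrite phiE grad_objective; [|exact: (dA _ Te).1|exact: (hlhat_diff _ Te).1].
  by rewrite addrAC subrr sub0r.
have hphi2 eta : Theta eta -> hess (phi eta) eta = - (sgn s *: Hs s lhat A eta).
  move=> Te; rewrite phiE (hess_diff (is_diff_grad_objective eta oT dA hlhat_diff Te)).
  by rewrite /Hs scalerA sgn_sqr scale1r opprB.
split; last split.
- by move=> eta Te Hp; exact: taylor2_curved Hp (hphi2 _ Te).
- move=> eta ts Te Hp; rewrite phiE => tsP att.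
  (* Either alternative yields local attainment. *)
  have {}att : locally_attained s Theta (objective A lhat) eta.
    by case: att => // pos; exact: locally_attained_global oT cT dA hlhat_diff pos _ _ Te tsP.
  have CE eta' t : is_ext s Theta (objective A lhat eta') t ->
      CBO s Theta ell prior g eta' = (objective A lhat eta' t)%:E.
    by rewrite hg hlhat; exact: CBO_attained.
  have D : is_diff eta (fine \o CBO s Theta ell prior g)
      (dotv ((eta - ts) *m hess A eta)).
    have [HT _] := pA _ Te.
    apply: is_diff_eq (danskin dA hlhat_diff Te tsP att _) _.
      by apply: filterE => eta' theta /CE /= ->.
    by apply/funext => h; rewrite dotv_mulmxl HT dotvC.
  split; [|exact: is_diff_differentiable D|exact: grad_diff D].
  (* Finiteness near [eta] follows from attainment, since an attained value is real. *)
  have [K [_ _]] := att; apply: filterS => eta' [theta _ /CE ->].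
  by [].
- move=> eta rho t Te Hp rho0.
  have Q := taylor2_argext Hp (hphi2 _ Te).
  exists (eta t + sgn s *: (grad (phi (eta t)) (eta t) *m invmx (Hs s lhat A (eta t)))).
  split=> //; rewrite /natural_gradient_step.
  (* The Hessian of [A] cancels against the preconditioner and the two signs multiply to 1, so both
     updates become the same expression. *)
  have -> : (sgn s *: ((eta t - (eta t + sgn s *:
      (grad (phi (eta t)) (eta t) *m invmx (Hs s lhat A (eta t))))) *m hess A (eta t)))
      *m invmx (hess A (eta t)) = grad lhat (eta t) *m invmx (Hs s lhat A (eta t)).
    rewrite -scalemxAl mulmxK; last exact/posdef_unitmx/pA.
    by rewrite opprD addrA subrr sub0r gphi// mulNmx !scalerN opprK scalerA sgn_sqr scale1r.
  by [].
Qed.
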